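(* Let $f,h:X\to\mathbb{R}\cup\{\infty\}$ satisfy the standing assumptions in the context. Suppose $\gamma>1$ is such that $h^*$ has $\gamma$-curvature relative to $\tilde f^*$ with constant $C^*$ (defined in the context), where $\tilde f(y)=f(-y)$. Let $(v_k,y_k,z_k)$, $k=0,1,2,\dots$, be the iterates generated by the generalized mirror descent algorithm (defined in the context), where $\alpha_0=1$ and for $k=1,2,\dots$ the step size $\alpha_k\in[0,1]$ is chosen by the line search $$\alpha_k\in\operatorname*{argmin}_{\alpha\in[0,1]}\bigl\{(1-\alpha)\,M_k+D_{h^*}(v_k-\alpha(z_k+v_k),v_k)\bigr\},$$ with $M_1=D_{h^*}(-z_0,v_0)$ and $M_{k+1}=(1-\alpha_k)M_k+D_{h^*}((1-\alpha_k)v_k-\alpha_kz_k,v_k)$ for $k=1,2,\dots$. Then for all $k=1,2,\dots$ $$f(\hat y_k)+h(\hat y_k)+f^*(-v_k)+h^*(v_k)\le C^*\left(\frac{\gamma}{k+\gamma}\right)^{\gamma-1},$$ where $\hat y_k$ is either of the following: $\hat y_k=\sum_{i=0}^{k-1}\lambda_i^ky_i$, or $\hat y_k$ is an element of $\{y_0,\dots,y_{k-1}\}$ minimizing $f(y_i)+h(y_i)$.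
   Context: Setting. $X$ is a finite-dimensional real vector space with dual $X^*$ and pairing $\langle\cdot,\cdot\rangle$. $f,h:X\to\mathbb{R}\cup\{\infty\}$ are proper closed convex functions with Fenchel conjugates $f^*,h^*:X^*\to\mathbb{R}\cup\{\infty\}$. $\operatorname{dom}(\partial f)\subseteq X$ and $\operatorname{dom}(\partial h^* )\subseteq X^*$ are the sets of points at which the respective subdifferential is nonempty. Single-valued oracles are fixed: for each $y\in\operatorname{dom}(\partial f)$, $\partial f(y)\in X^*$ denotes one fixed chosen element of $\operatorname{argmax}_{v\in X^*}\{\langle v,y\rangle-f^*(v)\}$ (the subdifferential of $f$ at $y$); for each $u\in\operatorname{dom}(\partial h^* )$, $\partial h^*(u)\in X$ denotes one fixed chosen element of $\operatorname{argmax}_{x\in X}\{\langle u,x\rangle-h(x)\}$ (the subdifferential of $h^*$ at $u$). Standing assumption: $-\partial f(y)\in\operatorname{dom}(\partial h^* )$ for all $y\in\operatorname{dom}(\partial f)$, and $\partial h^*(u)\in\operatorname{dom}(\partial f)$ for all $u\in\operatorname{dom}(\partial h^* )$. Generalized Bregman distance: $D_{h^*}(v,u)=h^*(v)-h^*(u)-\langle v-u,\partial h^*(u)\rangle$ for $u\in\operatorname{dom}(\partial h^* )$, $v\in\operatorname{dom}(h^* )$, with the chosen subgradient $\partial h^*(u)$. Relative $\gamma$-curvature of $h^*$ with respect to $\tilde f^*$: with the subgradient oracle of $\tilde f^{**}=\tilde f$ given by $\partial\tilde f(w)=-\partial f(-w)$, the function $h^*$ has $\gamma$-curvature relative to $\tilde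 f^*$ with (finite) constant $C^*$ if for all $v\in\operatorname{dom}(\partial h^* )$ and all $y\in\operatorname{dom}(\partial f)$, with $z=\partial f(y)$, one has $D_{h^*}(v+\alpha(-z-v),v)\le C^*\alpha^\gamma/\gamma$ for all $\alpha\in[0,1]$. Generalized mirror descent algorithm: given $v_0\in\operatorname{dom}(\partial h^* )$, for $k=0,1,2,\dots$: $y_k:=\partial h^*(v_k)$, $z_k:=\partial f(y_k)$, pick $\alpha_k\in[0,1]$, $v_{k+1}:=(1-\alpha_k)v_k-\alpha_kz_k$. The iterates are understood to be well defined, i.e. $v_k\in\operatorname{dom}(\partial h^* )$ for all $k$. Weights: for $k=0,1,2,\dots$, $\lambda^{k+1}_k=\alpha_k$ and $\lambda^{k+1}_i=(1-\alpha_k)\lambda^k_i$ for $i=0,\dots,k-1$. *)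

(* Defs.v *)
From HB Require Import structures.
From mathcomp Require Import all_boot all_order all_algebra.
From mathcomp Require Import all_classical all_reals all_analysis.

Set Implicit Arguments.
Unset Strict Implicit.
Unset Printing Implicit Defensive.

Import Order.TTheory GRing.Theory Num.Theory.
Import numFieldNormedType.Exports.

Local Open Scope classical_set_scope.
Local Open Scope ring_scope.

(* X : vectType R is a finite-dimensional real vector space and its dual is
   'Hom(X, R^o), with pairing <v, x> = v x. *)

Section Extremizers.
Context {R : realType} {T : Type}.
Implicit Types (A : set T) (F : T -> \bar R).

Definition argmin A F : set T := [set x | A x /\ forall y, A y -> (F x <= F y)%E].

Definition argmax F : set T := [set x | forall y, (F y <= F x)%E].

End Extremizers.

Section ConvexAnalysis.
Context {R : realType} {X : vectType R}.
Implicit Types (f h : X -> \bar R) (u v : 'Hom(X, R^o)) (x y : X).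
Local Open Scope ereal_scope.

Definition proper f := (forall x, f x != -oo) /\ (exists x, f x != +oo).

Definition convex_fun f := forall (t : R) x y, (0 <= t <= 1)%R ->
  f (t *: x + (1 - t) *: y)%R <= t%:E * f x + (1 - t)%R%:E * f y.

(* A vectType carries no canonical topology, so lower semicontinuity is read in
   the coordinates r2v : 'rV[R]_(dim X) -> X; all choices of coordinates give
   the same notion. *)
Definition closed_fun f := lower_semicontinuous (f \o @VectorInternalTheory.r2v R X).

Definition proper_closed_convex f := [/\ proper f, closed_fun f & convex_fun f].

Definition conjugate f v : \bar R := ereal_sup [set (v x : R)%:E - f x | x in setT].

(* For f proper closed convex, f^* is proper, so f^* v is finite for every
   element v of this argmax.  Likewise for subdiff_conj below. *)
Definition subdiff f y : set 'Hom(X, R^o) :=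
  argmax (fun v => (v y : R)%:E - conjugate f v).

(* The subdifferential of h^*, as a subset of X (identified with its bidual). *)
Definition subdiff_conj h u : set X := argmax (fun x => (u x : R)%:E - h x).

Definition dom_subdiff f : set X := [set y | subdiff f y !=set0].

Definition dom_subdiff_conj h : set 'Hom(X, R^o) :=
  [set u | subdiff_conj h u !=set0].

(* Subgradient oracles are total functions; their values are constrained (and
   meaningful) only on the domain of the subdifferential. *)
Definition oracle f (df : X -> 'Hom(X, R^o)) :=
  forall y, dom_subdiff f y -> subdiff f y (df y).

Definition oracle_conj h (dhs : 'Hom(X, R^o) -> X) :=
  forall u, dom_subdiff_conj h u -> subdiff_conj h u (dhs u).

(* The Bregman distance D(v, u) of h^* is meaningful for u in the domain of the
   subdifferential of h^* ; for such u it is +oo when h^* v is. *)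
Definition bregman_conj h (dhs : 'Hom(X, R^o) -> X) v u : \bar R :=
  conjugate h v - conjugate h u - ((v - u)%R (dhs u) : R)%:E.

(* gamma-curvature of h^* relative to the conjugate of f~, where f~ w = f (- w) has the
   oracle w |-> - df (- w): the target point of the segment issued from v is
   the value - df y of that oracle at w = - y. *)
Definition rel_curvature f (df : X -> 'Hom(X, R^o)) h
    (dhs : 'Hom(X, R^o) -> X) (gamma C : R) :=
  forall v y (a : R), dom_subdiff_conj h v -> dom_subdiff f y ->
    (0 <= a <= 1)%R ->
    bregman_conj h dhs (v + a *: (- df y - v))%R v <= (C * a `^ gamma / gamma)%R%:E.

End ConvexAnalysis.

Section Algorithm.
Context {R : realType} {X : vectType R}.

Record mirror_descent (h : X -> \bar R) (df : X -> 'Hom(X, R^o))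
    (dhs : 'Hom(X, R^o) -> X) (alpha : nat -> R)
    (v : nat -> 'Hom(X, R^o)) (y : nat -> X) (z : nat -> 'Hom(X, R^o)) : Prop :=
  MirrorDescent {
    md_dom : forall k, dom_subdiff_conj h (v k) ;
    md_y : forall k, y k = dhs (v k) ;
    md_z : forall k, z k = df (y k) ;
    md_alpha : forall k, 0 <= alpha k <= 1 ;
    md_v : forall k, v k.+1 = (1 - alpha k) *: v k - alpha k *: z k
  }.

(* weight alpha k i = lambda^k_i; the value is 0 for the irrelevant i >= k. *)
Fixpoint weight (alpha : nat -> R) (k i : nat) : R :=
  if k is k'.+1 then
    if i == k' then alpha k' else (1 - alpha k') * weight alpha k' i
  else 0.

End Algorithm.

(* Main.v *)
(** Since -v_k is the average of z_0, ..., z_{k-1} with weights lambda^k_i,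
    convexity of f^* and the Fenchel equalities
    f(y_k) = <z_k, y_k> - f^*(z_k) and h(y_k) = <v_k, y_k> - h^*(v_k) give by
    induction
    sum_i lambda^k_i (f + h)(y_i) + f^*(-v_k) + h^*(v_k) <= M_k,
    and Jensen's inequality replaces the weighted sum by (f + h)(yhat).
    Comparing the line search with the step r_k = gamma / (k + gamma) yields
    M_{k+1} <= (1 - r_k) M_k + C r_k^gamma / gamma, from which
    M_k <= C r_k^(gamma - 1) follows by induction.

    The Fenchel equality for f needs f = f^** at y_k: affine minorants of f are
    obtained by projecting onto its epigraph in coordinates. *)

Require Import Defs.
From HB Require Import structures.
From mathcomp Require Import all_boot all_order all_algebra.
From mathcomp Require Import all_classical all_reals all_analysis.
From mathcomp Require Import ring lra.

Set Implicit Arguments.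
Unset Strict Implicit.
Unset Printing Implicit Defensive.

Import Order.TTheory GRing.Theory Num.Theory.
Import numFieldNormedType.Exports.

Local Open Scope classical_set_scope.
Local Open Scope ring_scope.

(** * Projection onto a closed convex set of row vectors *)

Section Projection.
Context {R : realType} {n : nat}.
Implicit Types (u w x p q : 'rV[R]_n) (S : set 'rV[R]_n).

Definition dot u w : R := \sum_i u 0 i * w 0 i.

Lemma dotC u w : dot u w = dot w u.
Proof. by apply: eq_bigr => i _; rewrite mulrC. Qed.

Lemma dotDr u w x : dot u (w + x) = dot u w + dot u x.
Proof. by rewrite -big_split; apply: eq_bigr => i _; rewrite mxE mulrDr. Qed.

Lemma dotZr u (a : R) w : dot u (a *: w) = a * dot u w.
Proof. by rewrite mulr_sumr; apply: eq_bigr => i _; rewrite mxE mulrCA. Qed.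

Lemma dotBr u w x : dot u (w - x) = dot u w - dot u x.
Proof. by rewrite dotDr -scaleN1r dotZr mulN1r. Qed.

Lemma dotDl u w x : dot (u + w) x = dot u x + dot w x.
Proof. by rewrite dotC dotDr !(dotC x). Qed.

Lemma dotZl (a : R) u w : dot (a *: u) w = a * dot u w.
Proof. by rewrite dotC dotZr dotC. Qed.

Lemma dot_ge0 u : 0 <= dot u u.
Proof. by apply: sumr_ge0 => i _; rewrite -expr2 sqr_ge0. Qed.

Lemma dot_gt0 u : u != 0 -> 0 < dot u u.
Proof.
move=> u0; rewrite lt_def dot_ge0 andbT; apply: contra u0 => /eqP.
move/psumr_eq0P => u0; apply/eqP/rowP => i; rewrite mxE; apply/eqP.
by rewrite -sqrf_eq0 expr2 u0// => j _; rewrite -expr2 sqr_ge0.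
Qed.

Lemma continuous_sqdist q : continuous (fun x => dot (x - q) (x - q)).
Proof.
apply: continuous_big => [|i _ x]; first exact: add_continuous.
have cx : {for x, continuous (fun x => (x - q) 0 i)}.
  apply: (@continuous_comp _ _ _ (fun x => x - q) (fun u => u 0 i)).
    by apply: continuousB; [exact: id|exact: cst_continuous].
  exact: coord_continuous.
exact: (@continuousM _ _ _ _ x cx cx).
Qed.

Lemma bounded_sqdist q (r : R) : bounded_set [set x | dot (x - q) (x - q) <= r].
Proof.
exists (`|q| + (`|r| + 1)); split=> [|M /ltW rM x /= xr]; first exact: num_real.
apply: le_trans rM.
rewrite -{1}(subrKC q x); apply: le_trans (ler_normD _ _) _; rewrite lerD2l.
have -> : `|x - q| = mx_norm (x - q) by [].
rewrite mx_normrE; apply: bigmax_le => [|[i j] _].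
  by rewrite addr_ge0.
rewrite ord1 /=; set a := (x - q) 0 j.
have : a * a <= r.
  apply: le_trans xr; rewrite /dot (bigD1 j)//= lerDl.
  by apply: sumr_ge0 => k _; rewrite -expr2 sqr_ge0.
(* From [a * a <= r], the bound [|a| <= |r| + 1] follows without square roots. *)
have := ler_norm r; have := normr_ge0 r; rewrite -expr2 -(real_normK (num_real a)); nra.
Qed.

(** A nearest point p exists because a ball around q through a point of S cuts S down to a compact
    set. If the angle at p were acute, a short move from p toward x would come closer to q. *)
Lemma closed_convex_projection S q : S !=set0 -> closed S ->
  (forall (t : R) x w, 0 <= t <= 1 -> S x -> S w -> S (t *: x + (1 - t) *: w)) ->
  exists2 p, S p & forall x, S x -> dot (q - p) (x - p) <= 0.
Proof.
move=> [s Ss] cS convS; pose d x := dot (x - q) (x - q).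
pose A := S `&` [set x | d x <= d s].
have cA : closed A.
  apply: closedI => //.
  exact: (continuous_closedP d).1 (@continuous_sqdist q) _ (@closed_le _ (d s)).
have compA : compact A.
  apply: bounded_closed_compact => //.
  have [M [Mreal AM]] := bounded_sqdist q (d s).
  by exists M; split=> // N MN x [_ /AM]; exact.
have A0 : A !=set0 by exists s; split => //=.
have [p] := EVT_min_rV A0 compA (continuous_subspaceT (continuous_sqdist (q := q))).
rewrite inE => -[Sp dp] pmin.
exists p => // x Sx; rewrite leNgt; apply/negP => a_gt0.
have pminS w : S w -> d p <= d w.
  move=> Sw; have [ws|/ltW] := leP (d w) (d s); first by apply: pmin; rewrite inE.
  exact: le_trans.
set a := dot (q - p) (x - p) in a_gt0; set b := dot (x - p) (x - p).
have b_ge0 : 0 <= b by exact: dot_ge0.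
have ab_gt0 : 0 < a + b by rewrite ltr_pwDl.
(* The move changes the squared distance by [- 2 * t * a + t ^+ 2 * b]. Since [0 <= b], this t lies
   in []0, 1]], and [t * b <= a < 2 * a] makes the change negative. *)
pose t := a / (a + b).
have t0 : 0 < t by rewrite divr_gt0.
have t1 : t <= 1 by rewrite ler_pdivrMr// mul1r lerDl.
have : d p <= d (t *: x + (1 - t) *: p).
  by apply: pminS; apply: convS; rewrite ?t1 ?ltW.
have dE : d (t *: x + (1 - t) *: p) = d p - 2 * t * a + t ^+ 2 * b.
  rewrite /d /a /b; have -> : t *: x + (1 - t) *: p - q = t *: (x - p) - (q - p).
    by rewrite scalerBl scale1r scalerBr opprB -!addrA; congr (_ + _); rewrite addrCA.
  rewrite -[p - q]opprB; move: (x - p) (q - p) => u w.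
  rewrite -scaleN1r !(dotDl, dotDr, dotZl, dotZr) (dotC u w); ring.
rewrite dE => h; have {h} : 2 * a <= t * b by rewrite -(ler_pM2l t0); nra.
have : t * b <= a.
  by rewrite mulrAC ler_pdivrMr// ler_wpM2l ?lerDr// ltW.
lra.
Qed.

End Projection.

(** * Separation from an epigraph and affine minorants *)

Section Epigraph.
Context {R : realType} {n : nat}.
Implicit Types (g : 'rV[R]_n -> \bar R).

Lemma dot_row_mx (a b : 'rV[R]_1) (x w : 'rV[R]_n) :
  dot (row_mx a x) (row_mx b w) = a 0 0 * b 0 0 + dot x w.
Proof.
rewrite /dot big_split_ord /= big_ord1 !row_mxEl; congr (_ + _).
by apply: eq_bigr => i _; rewrite !row_mxEr.
Qed.

(** The height is the leading coordinate of a row, so that the projection lemma applies and [dot]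
    splits by [dot_row_mx]. *)
Definition epigraph g : set 'rV[R]_(1 + n) :=
  [set u | (g (rsubmx u) <= (lsubmx u 0 0)%:E)%E].

Lemma closed_epigraph g : lower_semicontinuous g -> closed (epigraph g).
Proof.
move=> lscg u clu; rewrite /epigraph /= leNgt; apply/negP => tg.
(* By lower semicontinuity g exceeds this intermediate level r near u, while heights near u stay
   below r. *)
have [r tr rg] : exists2 r : R, lsubmx u 0 0 < r & (r%:E < g (rsubmx u))%E.
  move: tg; case: (g _) => [s| |]//.
    rewrite lte_fin => ts; exists ((lsubmx u 0 0 + s) / 2); rewrite ?lte_fin; lra.
  by move=> _; exists (lsubmx u 0 0 + 1); rewrite ?ltry// ltrDl.
have [V nV gV] := lscg _ _ rg.
have nV' : nbhs u (rsubmx @^-1` V) by exact: continuous_rsubmx.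
have nr : nbhs u [set w : 'rV[R]_(1 + n) | lsubmx w 0 0 < r].
  have c : continuous (fun w : 'rV[R]_(1 + n) => lsubmx w 0 0).
    move=> w; apply: (@continuous_comp _ _ _ lsubmx (fun M : 'rV[R]_1 => M 0 0)).
      exact: continuous_lsubmx.
    exact: coord_continuous.
  by apply: (c u [set s | s < r]); apply: open_nbhs_nbhs; split => //; exact: open_lt.
have [w [/= ew [/= /gV rw lw]]] := clu _ (filterI nV' nr).
by have := lt_le_trans rw ew; rewrite lte_fin ltNge (ltW lw).
Qed.

Lemma convex_epigraph g (t : R) u w : convex_fun g -> 0 <= t <= 1 ->
  epigraph g u -> epigraph g w -> epigraph g (t *: u + (1 - t) *: w).
Proof.
move=> convg /[dup] t01 /andP[t0 t1]; rewrite /epigraph /= => gu gw.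
rewrite !linearD/= !linearZ/=.
have -> : (t *: lsubmx u + (1 - t) *: lsubmx w) 0 0 =
    t * lsubmx u 0 0 + (1 - t) * lsubmx w 0 0 by rewrite !mxE.
apply: le_trans (convg _ _ _ t01) _; rewrite [leRHS]EFinD !EFinM.
by apply: leeD; apply: lee_wpmul2l => //; rewrite lee_fin// subr_ge0.
Qed.

(* The second case is that of a vertical hyperplane. *)
Lemma separate_epigraph g (q : 'rV[R]_n) (r : R) :
    Defs.proper g -> lower_semicontinuous g -> convex_fun g -> (r%:E < g q)%E ->
  (exists w b, (forall x, ((dot w x + b)%:E <= g x)%E) /\ r <= dot w q + b) \/
  (exists w b, (forall x, (g x < +oo)%E -> dot w x <= b) /\ b < dot w q).
Proof.
move=> [gN [x0 x0fin]] lscg convg rq.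
have mk x t : (g x <= t%:E)%E -> epigraph g (row_mx (const_mx t) x).
  by rewrite /epigraph /= row_mxKl row_mxKr mxE.
have epi0 : epigraph g !=set0.
  exists (row_mx (const_mx (fine (g x0))) x0); apply: mk.
  by rewrite fineK// fin_numE gN.
(* The point of height r over q projects to the point of height s over p; the sign of [s - r]
   decides the kind of hyperplane. *)
have [u epiu sep] := closed_convex_projection (row_mx (const_mx r) q) epi0
  (closed_epigraph lscg) (fun t x w t01 => convex_epigraph convg t01).
set p := rsubmx u; set s := lsubmx u 0 0.
have gp : (g p <= s%:E)%E by [].
have {}sep x t : (g x <= t%:E)%E -> dot (q - p) (x - p) <= (s - r) * (t - s).
  move=> /mk /sep; rewrite -[u]hsubmxK !opp_row_mx !add_row_mx dot_row_mx !mxE.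
  have -> : u 0 (lshift n 0) = s by rewrite /s mxE.
  rewrite -/p; lra.
have [rs|rs|rs] := ltgtP r s.
- left; exists ((s - r)^-1 *: (q - p)), (s - (s - r)^-1 * dot (q - p) p).
  have sr0 : 0 < s - r by rewrite subr_gt0.
  split=> [x|]; last first.
    rewrite dotZl addrCA -mulrBr -dotBr; apply: ler_wpDr; last exact: ltW.
    by rewrite mulr_ge0 ?dot_ge0// invr_ge0 ltW.
  move gxE : (g x) => [t| |]; last 2 first.
  - by rewrite leey.
  - by have := gN x; rewrite gxE.
  have /sep : (g x <= t%:E)%E by rewrite gxE.
  rewrite lee_fin dotZl addrCA -mulrBr -dotBr -lerBrDl.
  by rewrite ler_pdivrMl.
(* The case [s < r] is impossible: moving straight up from the projection stays in the epigraph and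
   would come closer. *)
- have /sep : (g p <= (s + 1)%:E)%E.
    by apply: le_trans gp _; rewrite lee_fin lerDl.
  by rewrite subrr /dot big1 => [|i _]; [lra|rewrite !mxE mulr0].
- right; exists (q - p), (dot (q - p) p); split=> [x xfin|].
    have /sep : (g x <= (fine (g x))%:E)%E by rewrite fineK// fin_numE gN lt_eqF.
    by rewrite rs subrr mul0r dotBr subr_le0.
  rewrite -subr_gt0 -dotBr; apply: dot_gt0; rewrite subr_eq0.
  by apply: contraTneq rq => ->; rewrite -leNgt rs.
Qed.

(** A vertical hyperplane gets tilted: its functional [w - a] is nonpositive where g is finite and
    positive at q, so adding a large multiple of it to an affine minorant keeps a minorant and
    reaches r at q. *)
Lemma affine_minorant g (q : 'rV[R]_n) (r : R) :
    Defs.proper g -> lower_semicontinuous g -> convex_fun g -> (r%:E < g q)%E ->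
  exists w b, (forall x, ((dot w x + b)%:E <= g x)%E) /\ r <= dot w q + b.
Proof.
move=> pg lscg convg rq.
have [//|[w [a [wdom awq]]]] := separate_epigraph pg lscg convg rq.
have [gN [x0 x0fin]] := pg.
(* Below a finite value the separation cannot be vertical, so at least one affine minorant
   exists. *)
have gx0 : ((fine (g x0) - 1)%:E < g x0)%E.
  by rewrite -[ltRHS]fineK ?fin_numE ?gN// lte_fin gtrBl.
have [[w0 [b0 [minor _]]]|] := separate_epigraph pg lscg convg gx0; last first.
  move=> [w1 [a1 [/(_ x0) h]]]; rewrite ltNge h//.
  by rewrite ltey.
pose N := `|r - (dot w0 q + b0)| / (dot w q - a).
have N0 : 0 <= N by rewrite divr_ge0// subr_ge0 ltW.
exists (w0 + N *: w), (b0 - N * a); split=> [x|].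
  have [xfin|] := ltP (g x) +oo%E; last by rewrite leye_eq => /eqP ->; rewrite leey.
  apply: le_trans (minor x); rewrite lee_fin dotDl dotZl.
  have := ler_wpM2l N0 (wdom x xfin); lra.
have : N * (dot w q - a) = `|r - (dot w0 q + b0)|.
  by rewrite divfK// gt_eqF// subr_gt0.
rewrite dotDl dotZl; have := ler_norm (r - (dot w0 q + b0)); lra.
Qed.

End Epigraph.

(** * Conjugates and the Fenchel equalities *)

Section Conjugates.
Import VectorInternalTheory.
Context {R : realType} {X : vectType R}.
Implicit Types (f h : X -> \bar R) (u v w : 'Hom(X, R^o)) (x y : X).

Definition dot_coord (w : 'rV[R]_(dim X)) x : R^o :=
  dot w (v2r x).

Lemma dot_coord_linear (w : 'rV[R]_(dim X)) : linear (dot_coord w).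
Proof.
by move=> a x y; rewrite /dot_coord linearD linearZ dotDr dotZr.
Qed.

HB.instance Definition _ (w : 'rV[R]_(dim X)) :=
  GRing.isLinear.Build R X R^o *:%R (dot_coord w) (@dot_coord_linear w).

Lemma affine_minorant_dual f y (r : R) :
    proper_closed_convex f -> (r%:E < f y)%E ->
  exists v (b : R), (forall x, ((v x : R) + b)%:E <= f x)%E /\ r <= (v y : R) + b.
Proof.
move=> [[fN [x0 fx0]] lscf convf] ry.
have pg : Defs.proper (f \o @r2v R X).
  by split=> [x|]; [exact: fN|exists (v2r x0); rewrite /= v2rK].
have convg : convex_fun (f \o @r2v R X).
  by move=> t x x' t01; rewrite /= linearD !linearZ; exact: convf.
have rg : (r%:E < (f \o r2v) (v2r y))%E by rewrite /= v2rK.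
have [w [b [minor rb]]] := affine_minorant pg lscf convg rg.
exists (linfun (dot_coord w)), b; split=> [x|]; rewrite lfunE //.
by have := minor (v2r x); rewrite /= v2rK.
Qed.

Lemma fenchel_young f v x : ((v x : R)%:E - f x <= conjugate f v)%E.
Proof. by apply: ereal_sup_ubound; exists x. Qed.

Lemma conjugate_neqNy f v : Defs.proper f -> conjugate f v != -oo%E.
Proof.
move=> [fN [x fx]]; have := fenchel_young f v x.
move: (fN x) fx; case: (f x) => // s _ _; apply: contraTneq => ->.
by rewrite -EFinB -ltNge ltNyr.
Qed.

Lemma conjugate_le f v (b : R) :
  (forall x, (v x : R)%:E - f x <= b%:E)%E -> (conjugate f v <= b%:E)%E.
Proof. by move=> h; apply: ge_ereal_sup => _ [x _ <-]; exact: h. Qed.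

(* Fenchel-Moreau enters here: [subdiff] is defined through [conjugate f] and
   only determines the biconjugate of [f] at [y]. *)
Lemma subdiff_fenchel_eq f y z : proper_closed_convex f -> subdiff f y z ->
  exists2 b : R, conjugate f z = b%:E & f y = ((z y : R) - b)%:E.
Proof.
move=> pcf zmax; have [pf _ _] := pcf; have [fN _] := pf.
(* A minorant [v + b] reaching r at y has [conjugate f v <= - b], and z does at least as well as v
   in the maximum. *)
have below (r : R) : (r%:E < f y)%E -> (r%:E <= (z y : R)%:E - conjugate f z)%E.
  move=> /(affine_minorant_dual pcf)[v [b [minor rb]]].
  apply: le_trans (zmax v).
  have cv : (conjugate f v <= (- b)%:E)%E.
    apply: conjugate_le => x; move: (minor x) (fN x).
    case: (f x) => [s| |] // => [|_ _]; last exact: leNye.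
    by rewrite -EFinB !lee_fin => ? _; lra.
  have : (r%:E <= (v y : R)%:E - (- b)%:E)%E by rewrite -EFinB lee_fin opprK.
  by move=> /le_trans; apply; rewrite leeB.
have zN := conjugate_neqNy z pf.
(* An infinite conjugate at z would make the upper bound in [below] equal to [-oo]. *)
case cE : (conjugate f z) zN => [b| |]// _; last first.
  suff [r /below] : exists r : R, (r%:E < f y)%E by rewrite cE.
  move: (fN y); case: (f y) => [s| |] // _; last by exists 0; rewrite ltry.
  by exists (s - 1); rewrite lte_fin; lra.
exists b => //; rewrite cE -EFinB in below.
have := fenchel_young f z y; rewrite cE.
move: (fN y) below; case: (f y) => [s| |] // _ below.
  rewrite -EFinB lee_fin => fy; congr EFin; apply/eqP; rewrite eq_le.
  rewrite [X in _ && X]lerBlDr -lerBlDl fy andbT leNgt; apply/negP => bs.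
  by have := below (((z y : R) - b + s) / 2); rewrite lte_fin lee_fin; lra.
have /below : (((z y : R) - b + 1)%R%:E < +oo)%E by rewrite ltry.
by rewrite lee_fin gerDl ler10.
Qed.

(** The maximum attained at x is the very supremum that defines [conjugate h u]; properness makes
    both terms finite. *)
Lemma subdiff_conj_fenchel_eq h u x : Defs.proper h -> subdiff_conj h u x ->
  exists2 c : R, conjugate h u = c%:E & h x = ((u x : R) - c)%:E.
Proof.
move=> ph xmax; have [hN _] := ph.
have cE : conjugate h u = ((u x : R)%:E - h x)%E.
  apply/eqP; rewrite eq_le fenchel_young andbT.
  by apply: ge_ereal_sup => _ [x' _ <-]; exact: xmax.
have := conjugate_neqNy u ph; rewrite cE; move: (hN x).
case: (h x) => [s| |] // _ _.
by exists ((u x : R) - s); rewrite ?EFinB//; congr EFin; lra.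
Qed.

Lemma conjugate_convex f v w (t a b : R) : 0 <= t <= 1 ->
  conjugate f v = a%:E -> conjugate f w = b%:E ->
  (conjugate f ((1 - t) *: v + t *: w)%R <= ((1 - t) * a + t * b)%:E)%E.
Proof.
move=> /andP[t0 t1] va wb; apply: conjugate_le => x.
have := fenchel_young f v x; have := fenchel_young f w x; rewrite va wb.
case: (f x) => [s| |] // => [|_ _]; last exact: leNye.
rewrite -!EFinB !lee_fin => wx vx.
rewrite add_lfunE !scale_lfunE.
have := ler_wpM2l t0 wx; have := ler_wpM2l (_ : 0 <= 1 - t) vx.
rewrite subr_ge0 => /(_ t1); rewrite /GRing.scale/=; lra.
Qed.

End Conjugates.

(** * Monotonicity estimate behind the rate *)

Section Rate.
Context {R : realType}.
Implicit Types g t : R.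

Lemma ge1BV_ln (x : R) : 0 < x -> 1 - x^-1 <= ln x.
Proof.
move=> x0; have xV0 : 0 < x^-1 by rewrite invr_gt0.
rewrite -[ln x]opprK -lnV ?posrE// lerNr opprB.
by rewrite -{1}[x^-1](subrK 1) addrC; apply: le_ln1Dx; lra.
Qed.

(** In logarithms, with [s = t + g]: [(g - 1) * (ln (s + 1) - ln s) <= (g - 1) / s = 1 - (t + 1) / s
    <= ln (s / (t + 1))]. *)
Lemma rate_step g t : 1 < g -> 0 <= t ->
  (g / (t + g)) `^ (g - 1) * ((t + 1) / (t + g)) <= (g / (t + 1 + g)) `^ (g - 1).
Proof.
move=> g1 t0; set s := t + g; have s0 : 0 < s by rewrite /s; lra.
have -> : t + 1 + g = s + 1 by rewrite /s; ring.
have s10 : 0 < s + 1 by lra.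
have t10 : 0 < t + 1 by lra.
have g0 : 0 < g by lra.
have sV0 : 0 < s^-1 by rewrite invr_gt0.
rewrite -ler_ln ?posrE ?mulr_gt0 ?powR_gt0 ?divr_gt0//.
rewrite lnM ?posrE ?powR_gt0 ?divr_gt0// !ln_powR !ln_div ?posrE//.
have ls : ln (s + 1) - ln s <= s^-1.
  rewrite -ln_div ?posrE// mulrDl divff ?gt_eqF// mul1r; apply: le_ln1Dx; lra.
have := ge1BV_ln (divr_gt0 s0 t10); rewrite ln_div ?posrE// invf_div => lt.
have e : 1 - (t + 1) / s = (g - 1) * s^-1.
  by rewrite /s; field; rewrite gt_eqF.
have g10 : 0 <= g - 1 by lra.
by have := ler_wpM2l g10 ls; rewrite e in lt; lra.
Qed.

End Rate.

(** * Weighted averages of the iterates *)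

Section Weights.
Context {R : realType}.
Implicit Types (alpha : nat -> R).

(** The general module V covers both the points y and, through [R^o], their values. *)
Lemma weight_sum (V : lmodType R) alpha (y : nat -> V) k :
  \sum_(i < k.+1) weight alpha k.+1 i *: y i =
  (1 - alpha k) *: (\sum_(i < k) weight alpha k i *: y i) + alpha k *: y k.
Proof.
rewrite big_ord_recr /= eqxx scaler_sumr; congr (_ + _).
by apply: eq_bigr => i _; rewrite ltn_eqF ?scalerA.
Qed.

Lemma weight_sum1 (V : lmodType R) alpha (y : nat -> V) :
  alpha 0%N = 1 -> \sum_(i < 1) weight alpha 1 i *: y i = y 0%N.
Proof. by move=> a0; rewrite weight_sum a0 subrr scale0r add0r scale1r. Qed.

(** This serves the choice of [yhat] as a best iterate. *)
Lemma weight_sum_ge alpha (p : nat -> R) (a : R) k :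
  alpha 0%N = 1 -> (forall i, 0 <= alpha i <= 1) ->
  (forall i, (i <= k)%N -> a <= p i) ->
  a <= \sum_(i < k.+1) weight alpha k.+1 i *: (p i : R^o).
Proof.
move=> a0 a01; elim: k => [|k IHk] ap; first by rewrite weight_sum1// ap.
have /andP[ak0 ak1] := a01 k.+1.
rewrite weight_sum; set s := \sum_(i < _) _.
have {}IHk : a <= s by apply: IHk => i ik; rewrite ap// ltnW.
have := ap _ (leqnn k.+1); rewrite /GRing.scale/=; nra.
Qed.

Lemma weight_sum_convex (X : vectType R) (f : X -> \bar R) alpha (y : nat -> X)
    (p : nat -> R) k : convex_fun f ->
  alpha 0%N = 1 -> (forall i, 0 <= alpha i <= 1) ->
  (forall i, f (y i) = (p i)%:E) ->
  (f (\sum_(i < k.+1) weight alpha k.+1 i *: y i)%R <=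
    (\sum_(i < k.+1) weight alpha k.+1 i *: (p i : R^o))%R%:E)%E.
Proof.
move=> convf a0 a01 fy; elim: k => [|k IHk]; first by rewrite !weight_sum1// fy.
have /andP[ak0 ak1] := a01 k.+1.
rewrite 2!(weight_sum _ _ k.+1); move: (\sum_(i < k.+1) _) (\sum_(i < k.+1) _) IHk.
(* The new weight is written as [1 - (1 - alpha k.+1)] to match [convex_fun] at [1 - alpha k.+1]. *)
move=> x s fx; rewrite -{2}[alpha k.+1](subKr 1).
apply: le_trans (convf _ _ _ _) _; first by rewrite subr_ge0 ak1 gerBl.
rewrite subKr fy [leRHS]EFinD !EFinM; apply: leeD => //.
by apply: lee_wpmul2l => //; rewrite lee_fin subr_ge0.
Qed.

End Weights.

(** Inserting the bound on m gives [C * r ^ (g - 1) * (1 - r + r / g)], and the last factor is the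
    [(t + 1) / (t + g)] of [rate_step]. *)
Lemma rate_recursion (R : realType) (g t C m m' : R) (r := g / (t + g)) :
  1 < g -> 0 <= t -> 0 <= C -> m <= C * r `^ (g - 1) ->
  m' <= (1 - r) * m + C * r `^ g / g ->
  m' <= C * (g / (t + 1 + g)) `^ (g - 1).
Proof.
move=> g1 t0 C0 mr m'r; apply: le_trans (ler_wpM2l C0 (rate_step g1 t0)).
have g0 : 0 < g by lra.
have tg0 : 0 < t + g by lra.
have r0 : 0 <= r by rewrite divr_ge0 ?ltW.
have r1 : r <= 1 by rewrite ler_pdivrMr// mul1r lerDr.
have -> : (t + 1) / (t + g) = 1 - r + r / g.
  by rewrite /r; field; rewrite !gt_eqF.
move: m'r; rewrite -(mulr_powRB1 r0 g0) -/r; set P := r `^ _ in mr *.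
have := ler_wpM2l (_ : 0 <= 1 - r) mr; rewrite subr_ge0 => /(_ r1).
have -> : C * (r * P) / g = C * P * (r / g) by ring.
by lra.
Qed.

(** * Convergence of generalized mirror descent *)

Theorem corollary5 (R : realType) (X : vectType R) (f h : X -> \bar R)
    (df : X -> 'Hom(X, R^o)) (dhs : 'Hom(X, R^o) -> X)
    (f_pcc : proper_closed_convex f) (h_pcc : proper_closed_convex h)
    (df_oracle : oracle f df) (dhs_oracle : oracle_conj h dhs)
    (df_dom : forall y, dom_subdiff f y -> dom_subdiff_conj h (- df y))
    (dhs_dom : forall u, dom_subdiff_conj h u -> dom_subdiff f (dhs u))
    (gamma C : R) (gamma_gt1 : 1 < gamma)
    (curv : rel_curvature f df h dhs gamma C)
    (alpha : nat -> R) (v : nat -> 'Hom(X, R^o)) (y : nat -> X)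
    (z : nat -> 'Hom(X, R^o))
    (iterates : mirror_descent h df dhs alpha v y z)
    (M : nat -> \bar R)
    (alpha0 : alpha 0%N = 1)
    (line_search : forall k, (0 < k)%N ->
      argmin `[0, 1]
        (fun a : R => ((1 - a)%R%:E * M k
          + bregman_conj h dhs (v k - a *: (z k + v k))%R (v k))%E)
        (alpha k))
    (M1 : M 1%N = bregman_conj h dhs (- z 0%N) (v 0%N))
    (MS : forall k, (0 < k)%N ->
      M k.+1 = ((1 - alpha k)%R%:E * M k
        + bregman_conj h dhs ((1 - alpha k) *: v k - alpha k *: z k)%R (v k))%E)
    (k : nat) (k_gt0 : (0 < k)%N) (yhat : X)
    (yhatE : yhat = \sum_(i < k) weight alpha k i *: y i \/
      argmin [set y i | i in `I_k] (fun x => (f x + h x)%E) yhat) :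
  (f yhat + h yhat + conjugate f (- v k)%R + conjugate h (v k)
    <= (C * (gamma / (k%:R + gamma)) `^ (gamma - 1))%R%:E)%E.
Proof.
have [ph _ convh] := h_pcc; have [f_proper _ convf] := f_pcc.
have gamma_gt0 : 0 < gamma by lra.
have [vdom yE zE a01 vS] := iterates.
have ydom j : dom_subdiff f (y j) by rewrite yE; exact: dhs_dom.
(* All values at the iterates turn out finite, so the argument can move to the reals. *)
pose b j := fine (conjugate f (z j)); pose c j := fine (conjugate h (v j)).
pose p j := (z j (y j) : R) - b j; pose q j := (v j (y j) : R) - c j.
have [fz fy] : (forall j, conjugate f (z j) = (b j)%:E) /\
    (forall j, f (y j) = (p j)%:E).
  split=> j; have := df_oracle _ (ydom j); rewrite -zE => /(subdiff_fenchel_eq f_pcc);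
    by move=> [? E1 E2]; rewrite /p /b E1 ?E2.
have [hv hy] : (forall j, conjugate h (v j) = (c j)%:E) /\
    (forall j, h (y j) = (q j)%:E).
  split=> j; have := dhs_oracle _ (vdom j); rewrite -yE => /(subdiff_conj_fenchel_eq ph);
    by move=> [? E1 E2]; rewrite /q /c E1 ?E2.
(* This is the Bregman distance of one step, using [v j.+1 - v j = - alpha j *: (z j + v j)]. *)
pose d j := c j.+1 - c j + alpha j * ((z j (y j) : R) + (v j (y j) : R)).
have dE j : bregman_conj h dhs (v j.+1) (v j) = (d j)%:E.
  rewrite /bregman_conj !hv -yE -!EFinB vS; congr EFin.
  rewrite !(add_lfunE, opp_lfunE, scale_lfunE) /GRing.scale/= /d; ring.
have v1 : v 1%N = - z 0%N by rewrite vS alpha0 subrr scale0r scale1r sub0r.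
(* The sequence M starts at index 1, hence the shift in m. *)
have [m ME] : exists m, forall j, M j.+1 = (m j)%:E.
  exists (fun j => fine (M j.+1)); elim=> [|j IHj]; first by rewrite M1 -v1 dE.
  by rewrite MS// -vS dE IHj -EFinM -EFinD.
have m0 : m 0%N = d 0%N by apply: EFin_inj; rewrite -ME M1 -v1 dE.
have mS j : m j.+1 = (1 - alpha j.+1) * m j + d j.+1.
  by apply: EFin_inj; rewrite -ME MS// -vS dE ME.
have d0_le : d 0%N <= C * 1 `^ gamma / gamma.
  rewrite -lee_fin -dE.
  have := curv (v 0%N) (y 0%N) 1 (vdom _) (ydom _); rewrite ler01 lexx => /(_ isT).
  by rewrite scale1r addrC subrK -zE -v1.
(* The first Bregman distance is nonnegative by Fenchel-Young, and the curvature bound at step 1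
   dominates it. *)
have C_ge0 : 0 <= C.
  have : 0 <= d 0%N.
    have := fenchel_young h (v 1%N) (y 0%N); rewrite hv hy -EFinB lee_fin /d /q.
    by rewrite alpha0 {1}v1 opp_lfunE; lra.
  move=> /le_trans /(_ d0_le); rewrite powR1 mulr1 pmulr_lge0// invr_gt0; lra.
have rate j : m j <= C * (gamma / (j.+1%:R + gamma)) `^ (gamma - 1).
  elim: j => [|j IHj].
    (* At [t = 0] the step r is 1, so the fictitious previous term has coefficient 0. *)
    rewrite -[1%:R](add0r 1); apply: rate_recursion (lexx _) _ => //.
    rewrite m0 add0r divff ?gt_eqF ?(lt_trans ltr01)//.
    by rewrite subrr mul0r add0r.
  rewrite -[j.+2%:R]natr1; apply: rate_recursion IHj _ => //.
  (* This r is the competitor in the line search; curvature bounds its Bregman term. *)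
  set r := gamma / _.
  have r01 : 0 <= r <= 1.
    have jg : 0 < j.+1%:R + gamma by rewrite addr_gt0.
    apply/andP; split; first by rewrite divr_ge0// ltW.
    by rewrite ler_pdivrMr// mul1r lerDr.
  have [_ /(_ r)] := line_search j.+1 isT; rewrite /= in_itv /= r01 => /(_ isT).
  have step (a : R) : v j.+1 - a *: (z j.+1 + v j.+1) =
      (1 - a) *: v j.+1 - a *: z j.+1.
    by rewrite scalerBl scale1r scalerDr opprD addrA addrAC.
  rewrite {1}step -MS// !ME => h'.
  rewrite -lee_fin EFinD EFinM; apply: le_trans h' _; apply: leeD => //.
  have := curv (v j.+1) (y j.+1) r (vdom _) (ydom _) r01.
  by rewrite -zE -opprD scalerN.
have bound : (f yhat + h yhat <=
    (\sum_(i < k) weight alpha k i *: (p i + q i : R^o))%R%:E)%E.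
  case: k k_gt0 yhatE => // n _ [->|[[j jn <-] jmin]].
    have := leeD (weight_sum_convex n convf alpha0 a01 fy)
                 (weight_sum_convex n convh alpha0 a01 hy).
    rewrite -EFinD -big_split /=; under [X in (_ <= X%:E)%E]eq_bigr do rewrite -scalerDr.
    by [].
  rewrite fy hy -EFinD lee_fin; apply: (@weight_sum_ge _ _ (fun i => p i + q i)) => // i ni.
  by have := jmin (y i); rewrite fy hy fy hy -!EFinD lee_fin; apply; exists i.
(* Finiteness of the conjugate at [- v j.+1] is carried along, since [conjugate_convex] asks for
   real values. *)
have invariant j : exists2 e : R, conjugate f (- v j.+1) = e%:E &
    \sum_(i < j.+1) weight alpha j.+1 i *: (p i + q i : R^o) + e + c j.+1 <= m j.
  elim: j => [|j [e eE IHj]].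
    exists (b 0%N); first by rewrite v1 opprK.
    by rewrite (@weight_sum1 _ R^o alpha (fun i => p i + q i))// m0 /d /p /q alpha0; lra.
  have vE : - v j.+2 = (1 - alpha j.+1) *: (- v j.+1) + alpha j.+1 *: z j.+1.
    by rewrite vS opprB scalerN addrC.
  have := conjugate_convex (a01 j.+1) eE (fz j.+1); rewrite -vE.
  have := conjugate_neqNy (- v j.+2) f_proper.
  case: (conjugate f _) => [e'| |] // _; rewrite lee_fin => e'_le.
  exists e' => //; rewrite (@weight_sum _ R^o alpha (fun i => p i + q i)) mS /d /p /q.
  have [a0 a1] := andP (a01 j.+1).
  (* Convexity of the conjugate of f cancels the [b] inside [p], while the [c] inside [q] combines
     with the difference of [c] in [d]; what remains is the induction hypothesis scaled by
     [1 - alpha j.+1]. *)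
  move: IHj; set S := \sum_(i < _) _ => IHj.
  have := ler_wpM2l (_ : 0 <= 1 - alpha j.+1) IHj; rewrite subr_ge0 => /(_ a1).
  rewrite /GRing.scale /=; lra.
case: k k_gt0 bound {yhatE} => // n _ bound.
have [e -> inv] := invariant n; rewrite hv.
apply: le_trans (leeD2r _ (leeD2r _ bound)) _.
by rewrite -!EFinD lee_fin; apply: le_trans inv (rate n).
Qed.
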